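(* Let $f(x)=\frac1N\sum_{i=1}^N f(x,i)$, $x\in\mathbb{R}^n$, where each $f(\cdot,i):\mathbb{R}^n\to\mathbb{R}$ is continuously differentiable and bounded from below and each $\nabla f(\cdot,i)$ is Lipschitz continuous with parameter $L>0$. Let $\{x^t\}_{t\ge 1}$ be generated by the random reshuffling method with step sizes $\{\alpha_t\}_{t\ge1}$ (along an arbitrary sequence of permutations), assume that $\{x^t\}_{t\ge1}$ is bounded, and let $\mathcal{C}$ be its set of accumulation points. Assume that for every $\bar x\in\mathcal{C}$, $f$ satisfies the KL inequality at $\bar x$ with some $\eta\in(0,\infty]$ and some desingularizing function in $\mathcal{Q}_\eta$, and let $\delta,\eta>0$ and $\varrho\in\mathcal{Q}_\eta$ be such that the following uniformized KL inequality holds: for all $\bar x\in\mathcal{C}$ and all $x\in\mathbb{R}^n$ with $\mathrm{dist}(x,\mathcal{C})<\delta$ and $0<|f(x)-f(\bar x)|<\eta$, $$\varrho'(|f(x)-f(\bar x)|)\cdot\|\nabla f(x)\|\ge 1 .$$ Suppose that the step sizes satisfy $$\alpha_t\in\Big(0,\tfrac{1}{\sqrt2 LN}\Big]\ \ (t\ge 1),\qquad \sum_{t=1}^\infty\alpha_t=\infty,\qquad \sum_{t=1}^\infty\alpha_t^3<\infty,\qquad \sum_{t=1}^\infty\alpha_t\Big[\varrho'\Big(\sum_{j=t}^\infty\alpha_j^3\Big)\Big]^{-1}<\infty .$$ Then $$\sum_{t=1}^\infty\alpha_t\|\nabla f(x^{t-1})\|<\infty\qquad\text{and}\qquad\sum_{t=1}^\infty\|x^t-x^{t-1}\|<\infty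 .$$ Consequently, $\{x^t\}_{t\ge1}$ has finite length and converges to some stationary point $x^*$ of $f$ (i.e., $\nabla f(x^* )=0$).
   Context: Random reshuffling method: given $x^0\in\mathbb{R}^n$ and step sizes $\alpha_t>0$, at each iteration $t=1,2,\dots$ a permutation $\sigma^t=(\sigma^t_1,\dots,\sigma^t_N)$ of $\{1,\dots,N\}$ is chosen; set $\tilde x^t_0=x^{t-1}$, $\tilde x^t_i=\tilde x^t_{i-1}-\alpha_t\nabla f(\tilde x^t_{i-1},\sigma^t_i)$ for $i=1,\dots,N$, and $x^t=\tilde x^t_N$. (In the algorithm $\sigma^t$ is drawn uniformly at random; the result is about a single trajectory, i.e. an arbitrary fixed sequence of permutations.) Gradients are with respect to $x$. Set of accumulation points: $\mathcal{C}=\{x\in\mathbb{R}^n:\ \text{there is a subsequence } \{t_\ell\}_\ell \text{ with } x^{t_\ell}\to x\}$. For $\eta\in(0,\infty]$, $\mathcal{S}_\eta$ is the class of continuous concave functions $\varrho:[0,\eta)\to[0,\infty)$ with $\varrho\in C^1((0,\eta))$, $\varrho(0)=0$ and $\varrho'(s)>0$ for all $s\in(0,\eta)$. $\mathcal{Q}_\eta$ is the class of all $\varrho\in\mathcal{S}_\eta$ for which there is $C_\rho>0$ such that $[\varrho'(s+r)]^{-1}\le C_\rho\big[(\varrho'(s))^{-1}+(\varrho'(r))^{-1}\big]$ for all $s,r\in(0,\eta)$ with $s+r<\eta$. Here $[\cdot]^{-1}$ denotes the reciprocal. KL inequality at $\bar x$ with desingularizing function $\varrho\in\mathcal{S}_\eta$: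 there is a neighborhood $U$ of $\bar x$ such that $\varrho'(|f(x)-f(\bar x)|)\cdot\|\nabla f(x)\|\ge1$ for all $x\in U$ with $0<|f(x)-f(\bar x)|<\eta$. Convention: in the last step size condition, the finitely many indices $t$ with $\sum_{j=t}^\infty\alpha_j^3\ge\eta$ (where $\varrho'$ is not defined) are disregarded. *)

(* Defs.v *)
From HB Require Import structures.
From mathcomp Require Import all_boot all_order all_algebra perm.
From mathcomp Require Import all_classical all_reals all_analysis.

Set Implicit Arguments.
Unset Strict Implicit.
Unset Printing Implicit Defensive.

Import Order.TTheory GRing.Theory Num.Theory.
Import numFieldNormedType.Exports.

Local Open Scope classical_set_scope.
Local Open Scope ring_scope.

(* The library norm `|x| on 'rV[R]_n is the sup norm, so every metric notion
   below goes through the Euclidean norm; the topology (convergence,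
   neighborhoods, bounded sets, differentiability) is the library one, which
   coincides with the Euclidean one. *)
Definition enorm (R : realType) (n : nat) (x : 'rV[R]_n) : R :=
  Num.sqrt (\sum_(i < n) x ord0 i ^+ 2).

Definition edistance (R : realType) (n : nat) (x : 'rV[R]_n)
    (A : set 'rV[R]_n) : \bar R :=
  ereal_inf [set (enorm (x - y))%:E | y in A].

Definition grad (R : realType) (n : nat) (f : 'rV[R]_n -> R) (x : 'rV[R]_n) :
    'rV[R]_n :=
  \row_(i < n) ('D_(delta_mx ord0 i) f x).

Definition continuously_differentiable (R : realType) (n : nat)
    (f : 'rV[R]_n -> R) : Prop :=
  (forall x, differentiable f x) /\ continuous (grad f).

Definition lipschitz_gradient (R : realType) (n : nat) (L : R)
    (f : 'rV[R]_n -> R) : Prop :=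
  forall x y, enorm (grad f x - grad f y) <= L * enorm (x - y).

Definition average (R : realType) (n N : nat) (f : 'I_N -> 'rV[R]_n -> R) :
    'rV[R]_n -> R :=
  fun x => N%:R^-1 * \sum_(i < N) f i x.

(* [y t i] is the inner iterate written x~^t_i; the component functions and
   the entries of a permutation are numbered from 0, so step [i : 'I_N] leads
   from [y t i] to [y t i.+1].  The values [alpha 0] and [sigma 0] are unused. *)
Definition random_reshuffling (R : realType) (n N : nat)
    (f : 'I_N -> 'rV[R]_n -> R) (alpha : nat -> R) (sigma : nat -> {perm 'I_N})
    (x : nat -> 'rV[R]_n) : Prop :=
  exists y : nat -> nat -> 'rV[R]_n, forall t, (1 <= t)%N ->
    [/\ y t 0 = x t.-1,
        forall i : 'I_N,
          y t i.+1 = y t i - alpha t *: grad (f (sigma t i)) (y t i)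
      & x t = y t N].

Definition accumulation_points (R : realType) (n : nat)
    (x : nat -> 'rV[R]_n) : set 'rV[R]_n :=
  [set z | exists2 phi : nat -> nat,
     increasing_seq phi & (x \o phi) @ \oo --> z].

(* A function on [0, eta[ is represented by a total function on R whose values
   outside [0, eta[ are irrelevant. *)
Definition desingularizing (R : realType) (eta : \bar R) (rho : R -> R) :
    Prop :=
  let D := [set s : R | 0 <= s /\ (s%:E < eta)%E] in
  [/\ forall s, D s -> 0 <= rho s,
      {within D, continuous rho},
      convex_function (E := R^o) D (fun s => - rho s),
      rho 0 = 0
    & forall s, 0 < s -> (s%:E < eta)%E ->
        [/\ derivable rho s 1, {for s, continuous rho^`()%classic} & 0 < rho^`()%classic s]].

Definition quasi_additive_desingularizing (R : realType) (eta : \bar R)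
    (rho : R -> R) : Prop :=
  desingularizing eta rho /\
  exists2 C : R, 0 < C &
    forall s r, 0 < s -> 0 < r -> ((s + r)%:E < eta)%E ->
      (rho^`()%classic (s + r))^-1 <= C * ((rho^`()%classic s)^-1 + (rho^`()%classic r)^-1).

Definition KL_at (R : realType) (n : nat) (f : 'rV[R]_n -> R) (eta : \bar R)
    (rho : R -> R) (xbar : 'rV[R]_n) : Prop :=
  \forall x \near xbar,
    0 < `|f x - f xbar| -> (`|f x - f xbar|%:E < eta)%E ->
    1 <= rho^`()%classic `|f x - f xbar| * enorm (grad f x).

Definition uniform_KL (R : realType) (n : nat) (f : 'rV[R]_n -> R)
    (A : set 'rV[R]_n) (delta : R) (eta : \bar R) (rho : R -> R) : Prop :=
  forall xbar x, A xbar -> (edistance x A < delta%:E)%E ->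
    0 < `|f x - f xbar| -> (`|f x - f xbar|%:E < eta)%E ->
    1 <= rho^`()%classic `|f x - f xbar| * enorm (grad f x).

Definition cube_tail (R : realType) (alpha : nat -> R) (t : nat) : \bar R :=
  (\sum_(t <= j <oo) (alpha j ^+ 3)%:E)%E.

(* Main.v *)
(* One epoch is a gradient step of length N alpha_t with an error of order
   alpha_t on the bounded trajectory, so F = average f satisfies
     F(x^t) + c (alpha_t v_t^2 + w_t^2 / alpha_t) <= F(x^{t-1}) + A alpha_t^3
   with v_t = |grad F(x^{t-1})| and w_t = |x^t - x^{t-1}|.  Adding a multiple u_t
   of the tail of the series of alpha^3 to F(x^t) gives a nonincreasing energy
   E_t, whose limit l is the value of F on the accumulation points.  Concavity
   of rho, quasi-additivity of 1 / rho' and the KL inequality bound the decrease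
   of rho(E_t - l) from below by a multiple of
   (alpha_t v_t^2 + w_t^2 / alpha_t) / (v_t + 1 / rho'(u_{t-1})), and AM-GM turns
   this into
     alpha_t v_t + w_t
       <= K (rho(E_{t-1} - l) - rho(E_t - l)) + alpha_t / rho'(u_{t-1}),
   whose right-hand side is summable. *)

Require Import Defs.
From HB Require Import structures.
From mathcomp Require Import all_boot all_order all_algebra perm.
From mathcomp Require Import all_classical all_reals all_analysis.
From mathcomp Require Import ring lra.

Set Implicit Arguments.
Unset Strict Implicit.
Unset Printing Implicit Defensive.

Import Order.TTheory GRing.Theory Num.Theory.
Import numFieldNormedType.Exports.

Local Open Scope classical_set_scope.
Local Open Scope ring_scope.

(** * The Euclidean norm on row vectors *)

Section EuclideanNorm.
Variables (R : realType) (n : nat).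
Implicit Types (u v : 'rV[R]_n) (a : R).

Definition dotv u v : R := \sum_(i < n) u ord0 i * v ord0 i.

Lemma dotvC u v : dotv u v = dotv v u.
Proof. by apply: eq_bigr => i _; rewrite mulrC. Qed.

Lemma dotvDl u v w : dotv (u + v) w = dotv u w + dotv v w.
Proof. by rewrite -big_split; apply: eq_bigr => i _; rewrite mxE mulrDl. Qed.

Lemma dotvZl a u v : dotv (a *: u) v = a * dotv u v.
Proof. by rewrite mulr_sumr; apply: eq_bigr => i _; rewrite mxE mulrA. Qed.

Lemma dotvDr u v w : dotv w (u + v) = dotv w u + dotv w v.
Proof. by rewrite dotvC dotvDl !(dotvC _ w). Qed.

Lemma dotvZr a u v : dotv v (a *: u) = a * dotv v u.
Proof. by rewrite dotvC dotvZl dotvC. Qed.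

Lemma dotvNl u v : dotv (- u) v = - dotv u v.
Proof. by rewrite -scaleN1r dotvZl mulN1r. Qed.

Lemma dotvNr u v : dotv v (- u) = - dotv v u.
Proof. by rewrite dotvC dotvNl dotvC. Qed.

Lemma enorm_ge0 u : 0 <= enorm u.
Proof. exact: sqrtr_ge0. Qed.

Lemma enorm_sqr u : enorm u ^+ 2 = dotv u u.
Proof.
by rewrite sqr_sqrtr ?sumr_ge0// => i _; rewrite sqr_ge0.
Qed.

Lemma enorm0 : enorm (0 : 'rV[R]_n) = 0.
Proof.
by apply/eqP; rewrite -sqrf_eq0 enorm_sqr -(scale0r 0) dotvZl mul0r.
Qed.

Lemma enormZ a u : enorm (a *: u) = `|a| * enorm u.
Proof.
apply/eqP; rewrite -(eqrXn2 (n := 2))// ?mulr_ge0 ?enorm_ge0//.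
by rewrite exprMn !enorm_sqr real_normK ?num_real// dotvZl dotvZr mulrA expr2.
Qed.

Lemma enormN u : enorm (- u) = enorm u.
Proof. by rewrite -scaleN1r enormZ normrN1 mul1r. Qed.

Lemma enorm_distC u v : enorm (u - v) = enorm (v - u).
Proof. by rewrite -enormN opprB. Qed.

Lemma ler_coord_enorm u i : `|u ord0 i| <= enorm u.
Proof.
rewrite -ler_sqr ?nnegrE ?enorm_ge0// real_normK ?num_real// enorm_sqr.
rewrite /dotv (bigD1 i)//= -expr2 lerDl sumr_ge0// => j _.
by rewrite -expr2 sqr_ge0.
Qed.

Lemma enorm_eq0 u : enorm u = 0 -> u = 0.
Proof.
move=> u0; apply/rowP => i; rewrite mxE; apply/eqP.
by rewrite -normr_le0 -u0 ler_coord_enorm.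
Qed.

(** Cauchy-Schwarz: for nonzero vectors, expand the squared norm of [enorm v *: u - enorm u *: v]
    and cancel the positive factor [2 * (enorm u * enorm v)]. *)
Lemma ler_dotv u v : dotv u v <= enorm u * enorm v.
Proof.
have [->|u0] := eqVneq u 0.
  by rewrite enorm0 mul0r -(scale0r 0) dotvZl mul0r.
have [->|v0] := eqVneq v 0.
  by rewrite enorm0 mulr0 -(scale0r 0) dotvZr mul0r.
have pos (w : 'rV[R]_n) : w != 0 -> 0 < enorm w.
  by move=> w0; rewrite lt_neqAle enorm_ge0 andbT eq_sym; apply: contraNneq w0 =>
    /enorm_eq0 ->.
have := sqr_ge0 (enorm (enorm v *: u - enorm u *: v)).
rewrite enorm_sqr !(dotvDl, dotvDr, dotvNl, dotvNr, dotvZl, dotvZr).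
rewrite -!enorm_sqr (dotvC v u).
move=> h; suff : 0 <= 2 * (enorm u * enorm v) * (enorm u * enorm v - dotv u v).
  by rewrite pmulr_rge0 ?subr_ge0// !mulr_gt0 ?pos.
by move: h; lra.
Qed.

Lemma ler_enormD u v : enorm (u + v) <= enorm u + enorm v.
Proof.
rewrite -ler_sqr ?nnegrE ?addr_ge0 ?enorm_ge0//.
rewrite sqrrD !enorm_sqr dotvDl !dotvDr (dotvC v u).
have := ler_dotv u v; lra.
Qed.

Lemma ler_enorm_distD (w u v : 'rV[R]_n) :
  enorm (u - v) <= enorm (u - w) + enorm (w - v).
Proof. by rewrite (le_trans _ (ler_enormD _ _))// addrA subrK. Qed.

Lemma ler_enorm_sum (I : Type) (r : seq I) (P : pred I) (F : I -> 'rV[R]_n) :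
  enorm (\sum_(i <- r | P i) F i) <= \sum_(i <- r | P i) enorm (F i).
Proof.
elim/big_ind2 : _ => [|u a v b ua vb|//]; first by rewrite enorm0.
by rewrite (le_trans (ler_enormD _ _))// lerD.
Qed.

Lemma enorm_sqrB u v :
  enorm (u - v) ^+ 2 = enorm u ^+ 2 - 2 * dotv u v + enorm v ^+ 2.
Proof.
rewrite !enorm_sqr dotvDl !dotvDr !dotvNl !dotvNr (dotvC v u); ring.
Qed.

Lemma ler_norm_enorm u : `|u| <= enorm u.
Proof.
rewrite [leLHS]/Num.norm /= mx_normrE; apply/bigmax_leP => /=.
by split=> [|[i j] _ /=]; [exact: enorm_ge0|rewrite ord1 ler_coord_enorm].
Qed.

Lemma ler_coord_norm u i : `|u ord0 i| <= `|u|.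
Proof.
rewrite [leRHS]/Num.norm /= mx_normrE.
exact: (le_bigmax _ (fun ij : 'I_1 * 'I_n => `|u ij.1 ij.2|) (ord0, i)).
Qed.

(** With [ler_norm_enorm] this makes the sup and Euclidean norms equivalent, so that limits in the
    sup-norm topology can be read as Euclidean estimates. *)
Lemma ler_enorm_norm u : enorm u <= n%:R * `|u|.
Proof.
rewrite {1}(row_sum_delta u) (le_trans (ler_enorm_sum _ _ _))//.
have -> : n%:R * `|u| = \sum_(i < n) `|u|.
  by rewrite sumr_const card_ord mulr_natl.
apply: ler_sum => i _; rewrite enormZ.
suff -> : enorm (delta_mx ord0 i) = 1 :> R by rewrite mulr1 ler_coord_norm.
apply/eqP; rewrite -(eqrXn2 (n := 2)) ?enorm_ge0// enorm_sqr expr1n /dotv.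
rewrite (bigD1 i)//= big1 ?addr0 => [|j /negPf ji]; rewrite !mxE ?eqxx ?mulr1//=.
by rewrite ji mul0r.
Qed.

Lemma cvgr_enorm_dist_lt (u : nat -> 'rV[R]_n) v :
  u @ \oo --> v -> forall e, 0 < e -> \forall t \near \oo, enorm (u t - v) < e.
Proof.
move=> /cvgrPdist_lt uv e e0.
(* Dividing by [n.+1] rather than [n] covers dimension 0. *)
have e1 : 0 < e / n.+1%:R by rewrite divr_gt0.
near=> t; rewrite enorm_distC (le_lt_trans (ler_enorm_norm _))//.
rewrite (@le_lt_trans _ _ (n.+1%:R * `|v - u t|))//.
  by rewrite ler_wpM2r// ler_nat.
by rewrite mulrC -ltr_pdivlMr//; near: t; exact: uv.
Unshelve. all: by end_near. Qed.

End EuclideanNorm.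

(** * Gradients and the descent lemma *)

Section Gradient.
Variables (R : realType) (n : nat).
Implicit Types (x y d : 'rV[R]_n) (F : 'rV[R]_n -> R).

Lemma derive_grad F x d : differentiable F x -> 'D_d F x = dotv (grad F x) d.
Proof.
move=> dF; rewrite deriveE// {1}(row_sum_delta d) linear_sum.
by apply: eq_bigr => i _; rewrite linearZ/= mxE deriveE// mulrC.
Qed.

Lemma is_derive_line F x d (s : R) : differentiable F (x + s *: d) ->
  is_derive s 1 (fun r : R => F (x + r *: d)) (dotv (grad F (x + s *: d)) d).
Proof.
move=> dF.
have E : (fun h : R => h^-1 *: (((fun r => F (x + r *: d)) \o shift s) (h *: 1)
           - F (x + s *: d)))
       = (fun h => h^-1 *: ((F \o shift (x + s *: d)) (h *: d) - F (x + s *: d))).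
  apply/funext => h /=; congr (_ *: (F _ - _)).
  by rewrite [h *: 1]mulr1 scalerDl addrCA.
apply: DeriveDef; first by rewrite /derivable E; exact: diff_derivable.
by rewrite -derive_grad// /derive E.
Qed.

(** On the segment from [x] to [y], subtracting the quadratic model [q] from [F] leaves a function
    [g] whose derivative is nonpositive by Cauchy-Schwarz and the Lipschitz bound; comparing [g 1]
    with [g 0] needs no integral. *)
Lemma descent_lemma F (L : R) x y :
    (forall z, differentiable F z) -> lipschitz_gradient L F ->
  F y <= F x + dotv (grad F x) (y - x) + L / 2 * enorm (y - x) ^+ 2.
Proof.
move=> dF lipF; set d := y - x.
pose q (s : R) := s * dotv (grad F x) d + L / 2 * enorm d ^+ 2 * s ^+ 2.
pose g (s : R) := F (x + s *: d) - q s.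
pose dg (s : R) := dotv (grad F (x + s *: d)) d
  - (dotv (grad F x) d + L * enorm d ^+ 2 * s).
have gd (s : R) : is_derive s 1 g (dg s).
  have Fd := is_derive_line (dF (x + s *: d)).
  apply: is_deriveB.
  apply: is_derive_eq; rewrite /GRing.scale/=; by field.
have dg_le0 s : s \in `]0, 1[ -> dg s <= 0.
  rewrite in_itv/= => /andP[s0 _].
  rewrite /dg opprD addrA -dotvNl -dotvDl subr_le0.
  rewrite (le_trans (ler_dotv _ _))// expr2 mulrA mulrAC ler_wpM2r ?enorm_ge0//.
  by rewrite (le_trans (lipF _ _))// addrAC subrr add0r enormZ gtr0_norm// mulrA mulrAC.
have : g 1 <= g 0.
  apply: (@ler0_derive1_le_cc _ g 0 1); rewrite ?in_itv/= ?lexx ?ler01//.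
  - by move=> s s01; rewrite derive1E (derive_val (is_derive := gd s)) dg_le0.
  - apply: continuous_subspaceT => s.
    by apply: differentiable_continuous; apply/derivable1_diffP.
rewrite /g /q scale1r scale0r addr0 addrCA subrr addr0; lra.
Qed.

Lemma grad_average N (f : 'I_N -> 'rV[R]_n -> R) x :
    (forall i, differentiable (f i) x) ->
  grad (average f) x = N%:R^-1 *: \sum_(i < N) grad (f i) x.
Proof.
move=> df; apply/rowP => j; rewrite !mxE summxE.
have -> : average f = N%:R^-1 \*: (\sum_(i < N) f i).
  by apply/funext => z; rewrite /average /= fct_sumE.
have fj i : derivable (f i) x (delta_mx ord0 j) by exact: diff_derivable.
rewrite deriveZ; last exact: derivable_sum.
by rewrite derive_sum//; congr (_ *: _); apply: eq_bigr => i _; rewrite mxE.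
Qed.

Lemma differentiable_average N (f : 'I_N -> 'rV[R]_n -> R) x :
  (forall i, differentiable (f i) x) -> differentiable (average f) x.
Proof.
move=> df.
have -> : average f = N%:R^-1 \*: (\sum_(i < N) f i).
  by apply/funext => z; rewrite /average /= fct_sumE.
by apply: differentiableZ; apply: differentiable_sum.
Qed.

Lemma lipschitz_gradient_average N (f : 'I_N -> 'rV[R]_n -> R) (L : R) :
    (0 < N)%N -> (forall i x, differentiable (f i) x) ->
    (forall i, lipschitz_gradient L (f i)) ->
  lipschitz_gradient L (average f).
Proof.
move=> N0 df lf x y; rewrite !grad_average//.
rewrite -scalerBr -sumrB enormZ ger0_norm ?invr_ge0// ler_pdivrMl ?ltr0n//.
rewrite (le_trans (ler_enorm_sum _ _ _))//.
apply: (@le_trans _ _ (\sum_(i < N) L * enorm (x - y))).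
  by apply: ler_sum => i _; exact: lf.
by rewrite sumr_const card_ord mulr_natl.
Qed.

End Gradient.

(** * Desingularizing functions *)

Section Desingularizing.
Variables (R : realType) (eta : \bar R) (rho : R -> R).
Hypothesis rho_desing : desingularizing eta rho.
Implicit Types s r : R.

(** Concavity bounds every difference quotient from [s] towards [r] with step [h] in []0, 1]] below
    by [rho r - rho s]; the inequality survives the limit as [h] tends to 0 from the right. The
    point [r] may be 0. *)
Lemma desingularizing_tangent s r : 0 < s -> (s%:E < eta)%E ->
  0 <= r -> (r%:E < eta)%E -> rho r <= rho s + rho^`()%classic s * (r - s).
Proof.
move=> s0 seta r0 reta; have [_ _ cvx _ /(_ _ s0 seta)[ds _ _]] := rho_desing.
have dr : differentiable rho s by apply/derivable1_diffP.
rewrite -lerBlDl.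
have -> : rho^`()%classic s * (r - s) = 'D_(r - s) rho s.
  by rewrite derive1E !deriveE// -[in RHS](mulr1 (r - s)) linearZ mulrC.
have := @diff_derivable _ _ _ rho s (r - s) dr.
move/cvg_dnbhs_at_right => cvD.
rewrite /derive -(cvg_lim _ cvD)//; apply: limr_ge; first by apply: cvgP cvD.
near=> h.
have h0 : 0 < h by near: h; exact: nbhs_right_gt.
have h1 : h <= 1 by near: h; exact: nbhs_right_le.
rewrite -[_ *: _]/(_ * _) ler_pdivlMl//=.
have := cvx (Itv01 (ltW h0) h1) r s.
rewrite !inE => /(_ (conj r0 reta) (conj (ltW s0) seta)).
set c := conv _ _ _; have -> : c = h * (r - s) + s.
  by change (h * r + (1 - h) * s = h * (r - s) + s); ring.
rewrite convRE /= -[h *: _]/(h * _) /unstable.onem; lra.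
Unshelve. all: by end_near. Qed.

(** Adding the tangent inequalities at [s] and at [r] leaves a product of [r - s] with the
    difference of the derivatives. *)
Lemma desingularizing_deriv_ge s r : 0 < s -> s <= r -> (r%:E < eta)%E ->
  rho^`()%classic r <= rho^`()%classic s.
Proof.
move=> s0; rewrite le_eqVlt => /predU1P[->//|sr] reta.
have seta : (s%:E < eta)%E by rewrite (lt_trans _ reta)// lte_fin.
have r0 : 0 < r by exact: lt_trans sr.
have rs := desingularizing_tangent s0 seta (ltW r0) reta.
have sr' := desingularizing_tangent r0 reta (ltW s0) seta.
have : 0 < r - s by rewrite subr_gt0.
nra.
Qed.

End Desingularizing.

Section QuasiAdditive.
Variables (R : realType) (eta : \bar R) (rho : R -> R).

(* At s = 0 the derivative is meaningless, and the reciprocal of rho' is read as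
   0: the bound then only needs 1 <= C. *)
Lemma quasi_additive_const :
  quasi_additive_desingularizing eta rho ->
  exists2 C : R, 1 <= C &
    forall s r, 0 <= s -> 0 < r -> ((s + r)%:E < eta)%E ->
      (rho^`()%classic (s + r))^-1 <=
        C * ((if s == 0 then 0 else (rho^`()%classic s)^-1)
             + (rho^`()%classic r)^-1).
Proof.
move=> [[_ _ _ _ rho_deriv] [C C0 Cadd]]; exists (Num.max 1 C).
  by rewrite le_max lexx.
move=> s r s0 r0 sreta.
have reta : (r%:E < eta)%E by rewrite (le_lt_trans _ sreta)// lee_fin lerDr.
have [_ _ dr0] := rho_deriv _ r0 reta.
have [->|sn0] := eqVneq s 0.
  by rewrite !add0r ler_peMl ?invr_ge0 ?(ltW dr0)// le_max lexx.
have {sn0}s0 : 0 < s by rewrite lt_neqAle eq_sym sn0.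
have seta : (s%:E < eta)%E.
  by rewrite (le_lt_trans _ sreta)// lee_fin lerDl ltW.
have [_ _ ds0] := rho_deriv _ s0 seta.
rewrite (le_trans (Cadd _ _ s0 r0 sreta))// ler_wpM2r//.
  by rewrite addr_ge0// invr_ge0 ltW.
by rewrite le_max lexx orbT.
Qed.

(** Quasi-additivity at two equal arguments makes each doubling cost a factor [C * 2]. *)
Lemma quasi_additive_double :
  quasi_additive_desingularizing eta rho ->
  exists2 D : R, 0 < D &
    forall k s, 0 < s -> ((2 ^+ k * s)%:E < eta)%E ->
      (rho^`()%classic (2 ^+ k * s))^-1 <= D ^+ k * (rho^`()%classic s)^-1.
Proof.
move=> [_ [C C0 Cadd]]; exists (C * 2); first by rewrite mulr_gt0.
elim=> [|k IH] s s0; first by rewrite !expr0 !mul1r.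
have E : 2 ^+ k.+1 * s = 2 ^+ k * s + 2 ^+ k * s by rewrite exprS; ring.
have p0 : 0 < 2 ^+ k * s by rewrite mulr_gt0// exprn_gt0.
rewrite E => keta; rewrite (le_trans (Cadd _ _ p0 p0 keta))//.
rewrite -mulr2n -[X in C * X]mulr_natl mulrA [in leRHS]exprS -[leRHS]mulrA.
rewrite ler_wpM2l ?mulr_ge0 ?(ltW C0)//.
by rewrite IH// (le_lt_trans _ keta)// lee_fin lerDl ltW.
Qed.

End QuasiAdditive.

(** * One epoch of random reshuffling *)

Section Epoch.
Variables (R : realType) (n N : nat) (f : 'I_N -> 'rV[R]_n -> R) (L : R).
Variables (s : {perm 'I_N}) (z : nat -> 'rV[R]_n) (a G : R).
Hypothesis N_gt0 : (0 < N)%N.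
Hypothesis L_gt0 : 0 < L.
Hypothesis f_diff : forall i x, differentiable (f i) x.
Hypothesis f_lipschitz : forall i, lipschitz_gradient L (f i).
Hypothesis a_gt0 : 0 < a.
Hypothesis a_le : a <= 1 / (Num.sqrt 2 * L * N%:R).
Hypothesis grad_le : forall j, enorm (grad (f j) (z 0%N)) <= G.
Hypothesis z_step :
  forall i : 'I_N, z i.+1 = z i - a *: grad (f (s i)) (z i).

Let NR_gt0 : (0 : R) < N%:R. Proof. by rewrite ltr0n. Qed.

(* 1 / sqrt 2 <= 3 / 4 *)
Let aLN_le : a * L * N%:R <= 3 / 4.
Proof.
have s2 : (4 / 3 : R) <= Num.sqrt 2.
  by rewrite -ler_sqr ?nnegrE ?sqrtr_ge0// sqr_sqrtr//; lra.
move: a_le; rewrite ler_pdivlMr ?mulr_gt0 ?sqrtr_gt0// => h.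
have aLN0 : 0 < a * L * N%:R by rewrite !mulr_gt0.
nra.
Qed.

Let aL_le1 : a * L <= 1.
Proof.
have : 1 <= N%:R :> R by rewrite ler1n.
have := aLN_le; have : 0 < a * L by rewrite mulr_gt0.
nra.
Qed.

(** The drift [d] obeys [d' <= (1 + a * L) * d + a * G]. Since [a * L <= 1], adding [a * G] to both
    sides makes this a plain doubling, which iterates. *)
Lemma epoch_drift i : (i <= N)%N -> enorm (z i - z 0%N) + a * G <= 2 ^+ i * (a * G).
Proof.
elim: i => [|i IH] iN; first by rewrite subrr enorm0 add0r expr0 mul1r.
have := IH (ltnW iN); rewrite exprS => {}IH.
have zS := z_step (Ordinal iN); rewrite /= in zS.
set g := grad (f (s (Ordinal iN))) in zS.
have g_le : enorm (g (z i)) <= L * enorm (z i - z 0%N) + G.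
  rewrite -[g (z i)](subrK (g (z 0%N))) (le_trans (ler_enormD _ _))//.
  by rewrite lerD ?f_lipschitz// grad_le.
have : enorm (z i.+1 - z 0%N) <= enorm (z i - z 0%N) + a * enorm (g (z i)).
  by rewrite zS addrAC (le_trans (ler_enormD _ _))// enormN enormZ gtr0_norm.
have := enorm_ge0 (z i - z 0%N); move: g_le IH aL_le1 a_gt0.
move: (enorm (z i - _)) (enorm (g _)) (enorm (z i.+1 - _)) => d v e.
set P := 2 ^+ i * (a * G).
rewrite -[2 * 2 ^+ i * _]mulrA -/P; nra.
Qed.

(** The direction in which the epoch really moves: each component gradient is taken at its own inner
    iterate. *)
Let m := N%:R^-1 *: \sum_(i < N) grad (f (s i)) (z i).

Lemma epoch_displacement : z N - z 0%N = - ((a * N%:R) *: m).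
Proof.
rewrite /m scalerA mulfK ?gt_eqF//.
have : forall k (kN : (k <= N)%N), z k = z 0%N -
    a *: \sum_(i < k) grad (f (s (widen_ord kN i))) (z i).
  elim=> [kN|k IH kN]; first by rewrite big_ord0 scaler0 subr0.
  have zS := z_step (Ordinal kN); rewrite /= in zS.
  rewrite zS big_ord_recr/= {1}(IH (ltnW kN)) scalerDr opprD addrA.
  congr (_ - _ *: _ - _ *: grad (f (s _)) _); last exact: val_inj.
  by apply: eq_bigr => i _; congr (grad (f (s _)) _); exact: val_inj.
move=> /(_ _ (leqnn N)) ->; rewrite addrAC subrr add0r; congr (- (_ *: _)).
by apply: eq_bigr => i _; congr (grad (f (s _)) _); exact: val_inj.
Qed.

(** Reindexing the full gradient by the permutation matches its terms with those of [m]; each pair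
    then differs by at most [L] times the drift. *)
Lemma epoch_gradient_error :
  enorm (grad (average f) (z 0%N) - m) <= L * (2 ^+ N * (a * G)).
Proof.
have G0 : 0 <= a * G.
  by rewrite mulr_ge0 ?(ltW a_gt0)// (le_trans (enorm_ge0 _) (grad_le (Ordinal N_gt0))).
rewrite grad_average// /m (reindex_inj (@perm_inj _ s))/=.
rewrite -scalerBr -sumrB enormZ ger0_norm ?invr_ge0// ler_pdivrMl//.
rewrite (le_trans (ler_enorm_sum _ _ _))//.
apply: (@le_trans _ _ (\sum_(i < N) L * (2 ^+ N * (a * G)))); last first.
  by rewrite sumr_const card_ord mulr_natl.
apply: ler_sum => i _; rewrite (le_trans (f_lipschitz _ _ _))//.
rewrite ler_pM2l// enorm_distC.
have := epoch_drift (ltnW (ltn_ord i)).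
have : 2 ^+ i * (a * G) <= 2 ^+ N * (a * G).
  by rewrite ler_wpM2r// ler_eXn2l ?ltr1n// ltnW.
lra.
Qed.

(** Apply the descent lemma to the displacement [- (a * N) m] and write the inner product of [p] and
    [m] as half of [|p|^2 + |m|^2 - |p - m|^2]. As [a * L * N <= 3/4], the quadratic term consumes
    at most [3/8] of [a N |m|^2] out of the available [1/2]; the remaining [1/8] is the displacement
    term, and [|p - m|^2] yields the cubic error. *)
Lemma epoch_descent :
  average f (z N) + N%:R / 2 * (a * enorm (grad (average f) (z 0%N)) ^+ 2)
    + (8 * N%:R)^-1 * (enorm (z N - z 0%N) ^+ 2 / a)
  <= average f (z 0%N) + N%:R / 2 * (L * 2 ^+ N * G) ^+ 2 * a ^+ 3.
Proof.
have dF x : differentiable (average f) x by exact: differentiable_average.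
have := descent_lemma (z 0%N) (z N) dF (lipschitz_gradient_average N_gt0 f_diff f_lipschitz).
set p := grad _ _; rewrite epoch_displacement dotvNr dotvZr enormN enormZ.
rewrite ger0_norm ?mulr_ge0 ?(ltW a_gt0)//.
have err : enorm (p - m) ^+ 2 <= (L * (2 ^+ N * (a * G))) ^+ 2.
  have := epoch_gradient_error; rewrite -/p => h.
  by rewrite ler_sqr ?nnegrE ?enorm_ge0 ?(le_trans _ h) ?enorm_ge0.
rewrite enorm_sqrB in err.
move: (enorm p) (enorm m) (dotv p m) err aLN_le NR_gt0 a_gt0 => P M d.
set k : R := N%:R; move=> err aLk k0 a0 desc.
have -> : (8 * k)^-1 * ((a * k * M) ^+ 2 / a) = a * k * M ^+ 2 / 8.
  by field; rewrite !gt_eqF.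
have -> : k / 2 * (L * 2 ^+ N * G) ^+ 2 * a ^+ 3
    = a * k / 2 * (L * (2 ^+ N * (a * G))) ^+ 2 by field.
have ak0 : 0 < a * k by rewrite mulr_gt0.
have e1 : a * k / 2 * (P ^+ 2 - 2 * d + M ^+ 2)
    <= a * k / 2 * (L * (2 ^+ N * (a * G))) ^+ 2.
  by rewrite ler_wpM2l// divr_ge0// ltW.
have e2 : (a * L * k) * (a * k * M ^+ 2) <= 3 / 4 * (a * k * M ^+ 2).
  by rewrite ler_wpM2r// mulr_ge0 ?sqr_ge0// ltW.
move: desc e1 e2; rewrite !exprMn; lra.
Qed.

End Epoch.

(** * Nonnegative series and accumulation points *)

Section NonnegSeries.
Variable R : realType.
Implicit Types u : nat -> R.

(** Packages the tails as a real sequence, the total minus the partial sums, so that later estimates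
    stay in [R]. *)
Lemma nneseries_tail_fin u : (forall t, (1 <= t)%N -> 0 <= u t) ->
    (\sum_(1 <= t <oo) (u t)%:E < +oo)%E ->
  exists c : nat -> R,
    [/\ forall t, (1 <= t)%N -> (\sum_(t <= j <oo) (u j)%:E)%E = (c t)%:E,
        forall t, (1 <= t)%N -> c t = u t + c t.+1,
        forall t, (1 <= t)%N -> 0 <= c t,
        forall T m, (1 <= T)%N -> \sum_(T <= t < m) u t <= c T
      & c @ \oo --> 0].
Proof.
move=> u0 u_lty.
have uE0 t : (1 <= t)%N -> (0 <= (u t)%:E)%E by rewrite lee_fin; exact: u0.
pose S := (\sum_(1 <= t <oo) (u t)%:E)%E.
have SE : S = (fine S)%:E.
  by rewrite fineK// ge0_fin_numE//; apply: nneseries_ge0 => t t1 _; exact: uE0.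
pose c t := fine S - \sum_(1 <= j < t) u j.
have split_tail t : (1 <= t)%N ->
    S = ((\sum_(1 <= j < t) u j)%:E + \sum_(t <= j <oo) (u j)%:E)%E.
  by move=> t1; rewrite /S (nneseries_split 1 t.-1)// add1n prednK// sumEFin.
have tailE t : (1 <= t)%N -> (\sum_(t <= j <oo) (u j)%:E)%E = (c t)%:E.
  move=> /split_tail; rewrite {1}SE /c EFinB => ->.
  by rewrite addeAC subee// add0e.
exists c; split => //.
- by move=> t t1; rewrite /c big_nat_recr//=; ring.
- move=> t t1; rewrite -lee_fin -tailE//.
  by apply: nneseries_ge0 => j tj _; apply: uE0; exact: leq_trans tj.
- move=> T m T1; rewrite -lee_fin -tailE// -sumEFin.
  by apply: nneseries_lim_ge => t Tt _; apply: uE0; exact: leq_trans Tt.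
- rewrite -(subrr (fine S)); apply: cvgB; first exact: cvg_cst.
  apply: (@fine_cvg _ _ _ _ (fun t => (\sum_(1 <= j < t) u j)%:E)).
  rewrite -SE; under [X in X @ _]eq_fun do rewrite -sumEFin.
  by apply: is_cvg_nneseries => t t1 _; exact: uE0.
Qed.

Lemma nneseries_lty u (T : nat) (B : R) : (1 <= T)%N ->
    (forall t, (1 <= t)%N -> 0 <= u t) ->
    (forall m, \sum_(T <= t < m) u t <= B) ->
  (\sum_(1 <= t <oo) (u t)%:E < +oo)%E.
Proof.
move=> T1 u0 uB.
have uE0 t : (1 <= t)%N -> (0 <= (u t)%:E)%E by rewrite lee_fin; exact: u0.
rewrite (nneseries_split 1 T.-1)// add1n prednK// sumEFin.
rewrite (@le_lt_trans _ _ ((\sum_(1 <= t < T) u t)%:E + B%:E)%E) ?ltry//.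
rewrite leeD2l//; apply: lime_le.
  by apply: is_cvg_nneseries => t Tt _; apply: uE0; exact: leq_trans Tt.
by apply: nearW => m; rewrite sumEFin lee_fin.
Qed.

Lemma nneseries_lty_near u v (K : R) : 0 <= K ->
    (forall t, (1 <= t)%N -> 0 <= u t) -> (forall t, (1 <= t)%N -> 0 <= v t) ->
    (\forall t \near \oo, u t <= K * v t) ->
    (\sum_(1 <= t <oo) (v t)%:E < +oo)%E ->
  (\sum_(1 <= t <oo) (u t)%:E < +oo)%E.
Proof.
move=> K0 u0 v0 [T _ uv] v_lty.
have [c [_ _ _ vc _]] := nneseries_tail_fin v0 v_lty.
apply: (@nneseries_lty _ T.+1 (K * c T.+1)) => // m.
rewrite (@le_trans _ _ (\sum_(T.+1 <= t < m) K * v t))//.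
  by apply: ler_sum_nat => t /andP[/ltnW Tt _]; exact: uv.
by rewrite -mulr_sumr ler_wpM2l// vc.
Qed.

End NonnegSeries.
Lemma leq_increasing_seq (phi : nat -> nat) k : increasing_seq phi -> (k <= phi k)%N.
Proof.
move=> phi_incr; elim: k => // k IH; rewrite (leq_ltn_trans IH)//.
by move/increasing_seqP : phi_incr; exact.
Qed.

Lemma cvg_increasing_seq (phi : nat -> nat) : increasing_seq phi -> phi @ \oo --> \oo.
Proof.
move=> phi_incr A [M _ MA]; exists M => // k Mk; apply: MA => /=.
by rewrite (leq_trans Mk)// leq_increasing_seq.
Qed.

Section Accumulation.
Variables (R : realType) (n : nat) (x : nat -> 'rV[R]_n).
Hypothesis x_bounded : [bounded x t | t in [set t | (1 <= t)%N]].

(** Bolzano-Weierstrass along the indices in [P]: the filter [within P \oo] is proper because [P] is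
    infinite, and it clusters in a compact ball. Taking [P] to be all indices gives existence;
    taking the indices of distant iterates gives a contradiction. *)
Lemma accumulation_point_along (P : set nat) :
    (forall M, exists2 t, (M <= t)%N & P t) ->
  exists2 z, accumulation_points x z &
    forall e, 0 < e -> forall M, exists t, [/\ (M <= t)%N, P t & enorm (x t - z) < e].
Proof.
move=> P_inf; have [B [Breal xB]] := x_bounded.
pose K : set 'rV[R]_n := [set v | `|v| <= B + 1].
have K_compact : compact K.
  apply: bounded_closed_compact.
    by exists (B + 1); split; [exact: num_real|move=> r Br v /le_trans; apply; exact: ltW].
  apply: (@closed_comp _ _ (fun v : 'rV[R]_n => `|v|) [set r | r <= B + 1]).
    by move=> v _; exact: norm_continuous.
  exact: closed_le.
have F_proper : ProperFilter (within P \oo).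
  apply: Build_ProperFilter_ex => A [M _ MA].
  have [t Mt Pt] := P_inf M; exists t; exact: MA.
have xK : \forall t \near \oo, P t -> K (x t).
  near=> t => _; apply: xB; first by rewrite ltrDl.
  by near: t; exact: nbhs_infty_ge.
have [z [_ z_cluster]] := K_compact (x @ within P \oo) _ xK.
have close e M : 0 < e -> exists t, [/\ (M <= t)%N, P t & enorm (x t - z) < e].
  move=> e0.
  have : (x @ within P \oo) [set x t | t in [set t | (M <= t)%N /\ P t]].
    by exists M => // t /= Mt Pt; exists t.
  have e1 : 0 < e / n.+1%:R by rewrite divr_gt0.
  move=> /z_cluster /(_ (nbhsx_ballx z _ e1)) [_ [[t [Mt Pt] <-]]].
  rewrite -ball_normE /= => xz; exists t; split => //.
  rewrite enorm_distC (le_lt_trans (ler_enorm_norm _))//.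
  rewrite (@le_lt_trans _ _ (n.+1%:R * `|z - x t|)) ?ler_wpM2r ?ler_nat//.
  by rewrite mulrC -ltr_pdivlMr.
exists z; last by move=> e e0 M; exact: close.
have /choice[next nextP] : forall kM : nat * nat, exists t,
    [/\ (kM.2 <= t)%N, P t & enorm (x t - z) < kM.1.+1%:R^-1].
  by move=> [k M]; apply: (close k.+1%:R^-1 M); rewrite invr_gt0 ltr0n.
(* The lower bound [(phi j).+1] passed to [next] forces strict growth, and the first component
   forces closeness [1 / k.+1]. *)
pose phi := fix phi k := next (k, if k is j.+1 then (phi j).+1 else 0%N).
have phiP k : enorm (x (phi k) - z) < k.+1%:R^-1.
  by case: k => [|k]; [have [] := nextP (0%N, 0%N)|have [] := nextP (k.+1, (phi k).+1)].
exists phi.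
  by apply/increasing_seqP => k /=; have [] := nextP (k.+1, (phi k).+1).
apply/cvgrPdist_lt => e e0; near=> k.
rewrite distrC (le_lt_trans (ler_norm_enorm _))// (lt_trans (phiP k))//.
by near: k; exact: near_infty_natSinv_lt (PosNum e0).
Unshelve. all: by end_near. Qed.

Lemma near_accumulation_points (delta : R) : 0 < delta ->
  \forall t \near \oo, (edistance (x t) (accumulation_points x) < delta%:E)%E.
Proof.
move=> delta0; apply: contrapT => far.
pose P t := ~ (edistance (x t) (accumulation_points x) < delta%:E)%E.
have [M|z Cz /(_ _ delta0 0%N) [t [_ Pt xz]]] := @accumulation_point_along P.
  apply: contrapT => noP; apply: far; exists M => // t /= Mt.
  by apply: contrapT => Pt; apply: noP; exists t.
apply: Pt; apply: (@le_lt_trans _ _ (enorm (x t - z))%:E); last by rewrite lte_fin.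
by apply: ereal_inf_lbound; exists z.
Qed.

Lemma enorm_bounded : exists B, forall t, enorm (x t) <= B.
Proof.
have [B [_ xB]] := x_bounded.
(* Boundedness is assumed from index 1 on, whereas the first epoch starts at [x 0]. *)
exists (Num.max (enorm (x 0%N)) (n%:R * (B + 1))) => -[|t].
  by rewrite le_max lexx.
rewrite le_max; apply/orP; right.
rewrite (le_trans (ler_enorm_norm _))// ler_wpM2l//.
by apply: xB => //; rewrite ltrDl.
Qed.

End Accumulation.

(** * Summability from the KL inequality *)

(** Here [g] and [g'] are consecutive energy gaps, [v] the gradient norm, [w] the displacement, [a]
    the step size and [e] the contribution of the cubic tail. *)
Lemma KL_step (R : realType) (eta : \bar R) (rho : R -> R) (C P g g' v w a e : R) :
    desingularizing eta rho -> 0 < C -> 0 < P ->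
    0 < a -> 0 <= v -> 0 <= w -> 0 <= e ->
    0 <= g' -> (g%:E < eta)%E -> g' + P * (a * v ^+ 2 + w ^+ 2 / a) <= g ->
    (0 < g -> (rho^`()%classic g)^-1 <= C * (v + e)) ->
  a * v + w <= 4 * (C / P) * (rho g - rho g') + a * e.
Proof.
move=> rhoD C0 P0 a0 v0 w0 e0 g'0 geta descent slope.
have [rho_ge0 _ _ _ rho_deriv] := rhoD.
have X0 : 0 <= a * v ^+ 2 + w ^+ 2 / a.
  by rewrite addr_ge0 ?mulr_ge0 ?sqr_ge0 ?invr_ge0 ?(ltW a0).
have gap_ge0 : 0 <= P * (a * v ^+ 2 + w ^+ 2 / a) by rewrite mulr_ge0// ltW.
set X := a * v ^+ 2 + w ^+ 2 / a in X0 gap_ge0 descent *.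
pose Delta := rho g - rho g'; rewrite -/Delta.
have K0 : 0 < C / P by rewrite divr_gt0.
have [Delta0 XK] : 0 <= Delta /\ X <= C / P * Delta * (v + e).
  (* At [g = 0] there is no derivative to use, but the descent inequality then forces [g' = 0] and
     [X <= 0]. *)
  have [g_gt0|] := ltP 0 g; last first.
    move=> g_le0.
    have gE : g = 0 by lra.
    have g'E : g' = 0 by lra.
    have XE : P * X <= 0 by lra.
    rewrite /Delta gE g'E subrr mulr0 mul0r; split => //.
    by rewrite -(pmulr_rle0 _ P0).
  have [_ _ dg0] := rho_deriv _ g_gt0 geta.
  have g'eta : (g'%:E < eta)%E by rewrite (le_lt_trans _ geta)// lee_fin; lra.
  have tan := desingularizing_tangent rhoD g_gt0 geta g'0 g'eta.
  have := slope g_gt0; set d := rho^`()%classic g in dg0 tan * => sl.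
  have dX : d * (P * X) <= Delta.
    have : d * (P * X) <= d * (g - g') by rewrite ler_pM2l//; lra.
    by rewrite /Delta; lra.
  have Delta0 : 0 <= Delta by rewrite (le_trans _ dX)// mulr_ge0// ltW.
  split=> //; rewrite -(ler_pM2l P0).
  have -> : P * (C / P * Delta * (v + e)) = Delta * (C * (v + e)).
    by field; rewrite gt_eqF//.
  rewrite (le_trans _ (ler_wpM2l Delta0 sl))//.
  by rewrite ler_pdivlMr// [leLHS]mulrC; exact: dX.
move: (C / P) K0 XK => K K0 XK.
(* If [a * e] does not already dominate, then [a * v + a * e <= 2 * (a * v + w)], so one factor
   [a * v + w] cancels from the squared estimate; this 2 and the 2 of AM-GM make the constant 4. *)
have [za|az] := leP (a * v + w) (a * e).
  by rewrite (le_trans za)// lerDr !mulr_ge0 ?(ltW K0)//.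
(* AM-GM: (a v + w)^2 <= 2 a X, with X controlled by Delta * (v + e). *)
have z2 : (a * v + w) ^+ 2 <= 2 * a * X.
  have -> : 2 * a * X = 2 * (a * v) ^+ 2 + 2 * w ^+ 2.
    by rewrite /X; field; rewrite gt_eqF//.
  by have := sqr_ge0 (a * v - w); nra.
have z3 : (a * v + w) ^+ 2 <= (a * v + w) * (4 * K * Delta).
  rewrite (le_trans z2)//.
  have : a * X <= a * (K * Delta * (v + e)) by rewrite ler_pM2l.
  have : (K * Delta) * (a * v + a * e) <= (K * Delta) * (2 * (a * v + w)).
    by rewrite ler_wpM2l ?mulr_ge0 ?(ltW K0)//; lra.
  by lra.
have z0 : 0 < a * v + w by rewrite (le_lt_trans _ az)// mulr_ge0// ltW.
move: z3; rewrite expr2 ler_pM2l// => z3.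
by rewrite (le_trans z3)// lerDl mulr_ge0// ltW.
Qed.

Section FiniteLength.
Variables (R : realType) (n : nat) (F : 'rV[R]_n -> R) (x : nat -> 'rV[R]_n).
Variables (alpha : nat -> R) (P A : R).
Hypothesis F_cont : continuous F.
Hypothesis F_bounded_below : has_lbound (range F).
Hypothesis x_bounded : [bounded x t | t in [set t | (1 <= t)%N]].
Hypothesis alpha_gt0 : forall t, (1 <= t)%N -> 0 < alpha t.
Hypothesis P_gt0 : 0 < P.
Hypothesis descent : forall t, (1 <= t)%N ->
  F (x t) + P * (alpha t * enorm (grad F (x t.-1)) ^+ 2
                 + enorm (x t - x t.-1) ^+ 2 / alpha t)
  <= F (x t.-1) + A * alpha t ^+ 3.
Variables (delta : R) (eta : \bar R) (rho : R -> R).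
Hypothesis delta_gt0 : 0 < delta.
Hypothesis eta_gt0 : (0 < eta)%E.
Hypothesis rhoQ : quasi_additive_desingularizing eta rho.
Hypothesis F_KL : uniform_KL F (accumulation_points x) delta eta rho.
Hypothesis alpha_cube_sum : (\sum_(1 <= t <oo) (alpha t ^+ 3)%:E < +oo)%E.
Hypothesis alpha_rho_sum :
  (\sum_(1 <= t <oo | (cube_tail alpha t < eta)%E)
     (alpha t * (rho^`()%classic (fine (cube_tail alpha t)))^-1)%:E < +oo)%E.

(** The algorithm enters only through [descent]; permutations and component functions no longer
    appear. *)
Lemma KL_finite_length :
  (\sum_(1 <= t <oo) (alpha t * enorm (grad F (x t.-1))
                      + enorm (x t - x t.-1))%:E < +oo)%E.
Proof.
have cube_ge0 t : (1 <= t)%N -> 0 <= alpha t ^+ 3.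
  by move=> t1; rewrite exprn_ge0// ltW// alpha_gt0.
have [c [cE crec c_ge0 _ c0]] := nneseries_tail_fin cube_ge0 alpha_cube_sum.
have c_gt0 t : (1 <= t)%N -> 0 < c t.
  by move=> t1; rewrite crec// ltr_wpDr ?c_ge0// exprn_gt0// alpha_gt0.
have [k Ak] : exists k, A <= 2 ^+ k.
  exists (Num.bound `|A|); rewrite (le_trans (ler_norm _))//.
  rewrite (le_trans (ltW (archi_boundP (normr_ge0 _))))//.
  by rewrite -natrX ler_nat ltnW// ltn_expl.
(* The energy absorbs the cubic error of the descent inequality into a tail of
   the series of alpha^3; scaling the tail by a power of 2, rather than by A,
   lets quasi-additivity remove the factor again. *)
pose E t := F (x t) + 2 ^+ k * c t.+1.
(* The error of step [t.+1] is exactly [c t.+1 - c t.+2], whence the shifted index in [E]. *)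
have E_dec t : E t.+1 + P * (alpha t.+1 * enorm (grad F (x t)) ^+ 2
                 + enorm (x t.+1 - x t) ^+ 2 / alpha t.+1) <= E t.
  have := descent (ltn0Sn t); rewrite /= {2}/E crec// mulrDr /E.
  have : A * alpha t.+1 ^+ 3 <= 2 ^+ k * alpha t.+1 ^+ 3.
    by rewrite ler_wpM2r// cube_ge0.
  lra.
have E_noninc : nonincreasing_seq E.
  apply/nonincreasing_seqP => t; rewrite (le_trans _ (E_dec t))// lerDl.
  have /ltW a0 := alpha_gt0 (ltn0Sn t).
  apply: mulr_ge0; first exact: ltW.
  by apply: addr_ge0; [apply: mulr_ge0|apply: divr_ge0]; rewrite ?sqr_ge0.
have E_lb : has_lbound (range E).
  have [m mF] := F_bounded_below; exists m => _ [t _ <-].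
  have : m <= F (x t) by apply: mF; exists (x t).
  have : 0 <= 2 ^+ k * c t.+1 by rewrite mulr_ge0 ?c_ge0.
  by rewrite /E; lra.
have E_cvg := nonincreasing_is_cvgn E_noninc E_lb.
pose l : R := limn E.
have lE t : l <= E t by exact: nonincreasing_cvgn_ge.
have u_cvg : 2 ^+ k * c t.+1 @[t --> \oo] --> 0.
  rewrite -(mulr0 (2 ^+ k)); apply: cvgMr; rewrite ?cvg_shiftS//.
have Fx_cvg : F (x t) @[t --> \oo] --> l.
  have -> : (fun t => F (x t)) = E - (fun t => 2 ^+ k * c t.+1).
    by apply/funext => t; rewrite /E /= !fctE addrK.
  by rewrite -(subr0 l); apply: cvgB.
have F_acc z : accumulation_points x z -> F z = l.
  move=> [phi phi_incr xz].
  have Fz : F (x (phi t)) @[t --> \oo] --> F z.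
    by apply: (@cvg_comp _ _ _ (x \o phi) F _ _ _ xz); exact: F_cont.
  have Fl : F (x (phi t)) @[t --> \oo] --> l.
    exact: (@cvg_comp _ _ _ phi (F \o x) _ _ _ (cvg_increasing_seq phi_incr) Fx_cvg).
  exact: (cvg_unique _ Fz Fl).
(* Since [F] equals [l] at every accumulation point, one fixed [z] can serve as reference point in
   the KL inequality for all iterates. *)
have [//|z Cz _] := @accumulation_point_along _ _ _ x_bounded setT.
  by move=> M; exists M.
(* [eta] may be infinite, so a finite [eta0] is split into halves, one for [F (x t) - l] and one for
   the tail. *)
have [eta0 eta0_gt0 eta0_le] : exists2 e : R, 0 < e & (e%:E <= eta)%E.
  by move: eta_gt0; case: eta => [r r0| _|//]; [exists r|exists 1; rewrite ?leey].
have eta0_half : 0 < eta0 / 2 by rewrite divr_gt0.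
have [T _ near_limit] : \forall t \near \oo,
    [/\ (edistance (x t) (accumulation_points x) < delta%:E)%E,
       `|F (x t) - l| < eta0 / 2 & 2 ^+ k * c t.+1 < eta0 / 2].
  near=> t; split.
  - by near: t; exact: near_accumulation_points.
  - by rewrite distrC; near: t; move/cvgrPdist_lt : Fx_cvg; exact.
  - by near: t; exact: cvgr_lt u_cvg _ eta0_half.
have [C C1 C_add] := quasi_additive_const rhoQ.
have [D D0 D_double] := quasi_additive_double rhoQ.
have C0 : 0 < C by rewrite (lt_le_trans ltr01).
have [rhoD _] := rhoQ; have [rho_ge0 _ _ _ rho_deriv] := rhoD.
have u_eta t : (T <= t)%N -> ((2 ^+ k * c t.+1)%:E < eta)%E.
  move=> /near_limit[_ _ uh]; rewrite (lt_le_trans _ eta0_le)// lte_fin; lra.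
have c_eta t : (T <= t)%N -> ((c t.+1)%:E < eta)%E.
  move=> /u_eta; apply: le_lt_trans; rewrite lee_fin ler_peMl ?c_ge0//.
  by rewrite exprn_ege1// ler1n.
pose e t := D ^+ k * (rho^`()%classic (c t.+1))^-1.
have e_ge0 t : (T <= t)%N -> 0 <= e t.
  move=> /c_eta/(rho_deriv _ (c_gt0 t.+1 isT))[_ _ d0].
  by rewrite mulr_ge0 ?exprn_ge0 ?invr_ge0 ?ltW.
have step t : (T <= t)%N ->
    alpha t.+1 * enorm (grad F (x t)) + enorm (x t.+1 - x t)
    <= 4 * (C / P) * (rho (E t - l) - rho (E t.+1 - l)) + alpha t.+1 * e t.
  move=> Tt; have [xt_near Fl ul] := near_limit _ Tt.
  set q := `|F (x t) - l|; set u := 2 ^+ k * c t.+1 in ul.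
  have u0 : 0 < u by rewrite mulr_gt0 ?c_gt0 ?exprn_gt0.
  have qu_eta : ((q + u)%:E < eta)%E.
    by rewrite (lt_le_trans _ eta0_le)// lte_fin /q; lra.
  have gap_le : E t - l <= q + u by rewrite /E /q -/u; have := ler_norm (F (x t) - l); lra.
  apply: (KL_step rhoD) => //; rewrite ?enorm_ge0 ?alpha_gt0 ?e_ge0//.
  - by rewrite subr_ge0 lE.
  - by rewrite (le_lt_trans _ qu_eta)// lee_fin.
  - by rewrite addrAC lerB// E_dec.
  (* As [F (x t) - l] may be negative, the gap is enlarged to [q + u], where [1 / rho'] is no
     smaller. Quasi-additivity then separates [q], handled by the KL inequality, from [u], handled
     by doubling. *)
  move=> gap0; have dle := desingularizing_deriv_ge rhoD gap0 gap_le qu_eta.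
  have qu0 : 0 < q + u by rewrite (lt_le_trans gap0).
  have [_ _ dqu0] := rho_deriv _ qu0 qu_eta.
  rewrite (@le_trans _ _ (rho^`()%classic (q + u))^-1)//.
    by rewrite lef_pV2// posrE (lt_le_trans dqu0).
  rewrite (le_trans (C_add _ _ (normr_ge0 _) u0 qu_eta))// ler_pM2l//.
  apply: lerD; last by apply: D_double; [exact: c_gt0|exact: u_eta].
  (* At [q = 0] the KL inequality says nothing, and the reciprocal counts as 0. *)
  case: ifPn => [_|q_neq0]; first exact: enorm_ge0.
  have q0 : 0 < q by rewrite lt_neqAle eq_sym q_neq0 normr_ge0.
  have q_eta : (q%:E < eta)%E by rewrite (le_lt_trans _ qu_eta)// lee_fin lerDl ltW.
  have [_ _ dq0] := rho_deriv _ q0 q_eta.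
  rewrite -[_^-1]mul1r ler_pdivrMr// mulrC /q -(F_acc _ Cz).
  by apply: F_KL => //; rewrite (F_acc _ Cz).
(* Setting the disregarded indices to 0 gives an unconditional series; past [T] every index lies in
   the first branch by [c_eta]. *)
pose b t := if (cube_tail alpha t < eta)%E
  then alpha t * (rho^`()%classic (fine (cube_tail alpha t)))^-1 else 0.
have b_ge0 t : (1 <= t)%N -> 0 <= b t.
  move=> t1; rewrite /b /cube_tail cE//=; case: ifPn => // ct.
  by have [_ _ d0] := rho_deriv _ (c_gt0 _ t1) ct; rewrite mulr_ge0 ?invr_ge0 ?ltW ?alpha_gt0.
have b_sum : (\sum_(1 <= t <oo) (b t)%:E < +oo)%E.
  move: alpha_rho_sum; rewrite eseries_mkcond; congr (_ < _)%E.
  by apply: eq_eseriesr => t _; rewrite /b; case: ifPn.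
have [B [_ _ B_ge0 bB _]] := nneseries_tail_fin b_ge0 b_sum.
pose z' t := alpha t * enorm (grad F (x t.-1)) + enorm (x t - x t.-1).
apply: (@nneseries_lty _ z' T.+1 (4 * (C / P) * rho (E T - l) + D ^+ k * B T.+1)) => //.
  by move=> t t1; rewrite addr_ge0 ?mulr_ge0 ?enorm_ge0 ?ltW ?alpha_gt0.
(* The differences of [rho] telescope; the last value is nonnegative by [rho_gap] and is dropped at
   the end. *)
have partial j : \sum_(T.+1 <= t < T.+1 + j) z' t <=
    4 * (C / P) * (rho (E T - l) - rho (E (T + j)%N - l))
    + D ^+ k * \sum_(T.+1 <= t < T.+1 + j) b t.
  elim: j => [|j IH]; first by rewrite !addn0 !big_geq// subrr !mulr0 addr0.
  rewrite addSn in IH; rewrite addSn addnS.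
  rewrite (big_nat_recr _ _ _ (_ : T.+1 <= (T + j).+1)%N) ?ltnS ?leq_addr//=.
  rewrite [X in _ <= _ + _ * X]big_nat_recr ?ltnS ?leq_addr//=.
  have := step (T + j)%N (leq_addr _ _); rewrite {2}/z' /=.
  have -> : b (T + j).+1 = alpha (T + j).+1 * (rho^`()%classic (c (T + j).+1))^-1.
    by rewrite /b /cube_tail cE//= c_eta// leq_addr.
  move: IH; rewrite /e; lra.
have rho_gap t : (T <= t)%N -> 0 <= rho (E t - l).
  move=> /near_limit[_ Fl ul]; apply: rho_ge0; split; first by rewrite subr_ge0.
  rewrite (lt_le_trans _ eta0_le)// lte_fin /E.
  by have := ler_norm (F (x t) - l); lra.
move=> m; have [mT|Tm] := leqP m T.+1.
  rewrite big_geq//; apply: addr_ge0; apply: mulr_ge0; rewrite ?rho_gap ?B_ge0//.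
    by rewrite mulr_ge0 ?divr_ge0// ltW.
  by rewrite exprn_ge0// ltW.
rewrite -(subnKC (ltnW Tm)) (le_trans (partial _))//.
apply: lerD; last by rewrite ler_wpM2l ?bB// exprn_ge0// ltW.
rewrite ler_wpM2l//; first by rewrite mulr_ge0 ?divr_ge0// ltW.
by rewrite gerBl rho_gap// leq_addr.
Unshelve. all: by end_near.
Qed.
End FiniteLength.

(** * From single epochs to the whole trajectory, and convergence *)

Lemma lipschitz_gradient_bounded (R : realType) (n N : nat)
    (f : 'I_N -> 'rV[R]_n -> R) (L B : R) (x : nat -> 'rV[R]_n) : 0 <= L ->
    (forall i, lipschitz_gradient L (f i)) -> (forall t, enorm (x t) <= B) ->
  exists G, forall i t, enorm (grad (f i) (x t)) <= G.
Proof.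
(* Gradients are compared with those at the origin; summing over the components stands in for a
   maximum. *)
move=> L0 lf xB; exists (\sum_(j < N) enorm (grad (f j) 0) + L * B) => i t.
rewrite -[grad _ _](subrK (grad (f i) 0)) (le_trans (ler_enormD _ _))// addrC.
apply: lerD.
  by rewrite (bigD1 i)//= lerDl sumr_ge0// => j _; exact: enorm_ge0.
by rewrite (le_trans (lf _ _ _))// subr0 ler_wpM2l.
Qed.

(** Casts [epoch_descent] in the form required by [KL_finite_length]: as [1 / (8 N) <= N / 2], the
    smaller coefficient serves both terms. *)
Lemma random_reshuffling_descent (R : realType) (n N : nat)
    (f : 'I_N -> 'rV[R]_n -> R) (L G : R) (alpha : nat -> R)
    (sigma : nat -> {perm 'I_N}) (x : nat -> 'rV[R]_n) (t : nat) :
    (0 < N)%N -> 0 < L -> (forall i z, differentiable (f i) z) ->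
    (forall i, lipschitz_gradient L (f i)) ->
    random_reshuffling f alpha sigma x ->
    (forall i s, enorm (grad (f i) (x s)) <= G) ->
    (1 <= t)%N -> 0 < alpha t <= 1 / (Num.sqrt 2 * L * N%:R) ->
  average f (x t) + (8 * N%:R)^-1 *
    (alpha t * enorm (grad (average f) (x t.-1)) ^+ 2
     + enorm (x t - x t.-1) ^+ 2 / alpha t)
  <= average f (x t.-1) + N%:R / 2 * (L * 2 ^+ N * G) ^+ 2 * alpha t ^+ 3.
Proof.
move=> N0 L0 df lf [y /(_ t)yP] gG t1 /andP[a0 aL].
have [y0 ystep yN] := yP t1.
have gy j : enorm (grad (f j) (y t 0%N)) <= G by rewrite y0.
have := epoch_descent N0 L0 df lf a0 aL gy ystep; rewrite y0 -yN => desc.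
rewrite (le_trans _ desc)// mulrDr addrA lerD2r lerD2l.
rewrite ler_wpM2r ?mulr_ge0 ?enorm_ge0 ?(ltW a0)//.
have N1 : 1 <= N%:R :> R by rewrite ler1n.
rewrite -div1r ler_pdivrMr ?mulr_gt0 ?ltr0n//; nra.
Qed.

Theorem theorem3p6 (R : realType) (n N : nat) (N_gt0 : (0 < N)%N)
    (f : 'I_N -> 'rV[R]_n -> R) (L : R) (L_gt0 : 0 < L)
    (f_C1 : forall i, continuously_differentiable (f i))
    (f_bounded_below : forall i, has_lbound (range (f i)))
    (f_lipschitz : forall i, lipschitz_gradient L (f i))
    (alpha : nat -> R) (sigma : nat -> {perm 'I_N}) (x : nat -> 'rV[R]_n)
    (x_RR : random_reshuffling f alpha sigma x)
    (x_bounded : [bounded x t | t in [set t | (1 <= t)%N]])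
    (f_KL : forall xbar, accumulation_points x xbar ->
       exists (eta' : \bar R) (rho' : R -> R),
         [/\ (0 < eta')%E, quasi_additive_desingularizing eta' rho'
           & KL_at (average f) eta' rho' xbar])
    (delta : R) (eta : \bar R) (rho : R -> R)
    (delta_gt0 : 0 < delta) (eta_gt0 : (0 < eta)%E)
    (rhoQ : quasi_additive_desingularizing eta rho)
    (f_uniform_KL :
       uniform_KL (average f) (accumulation_points x) delta eta rho)
    (alpha_bounds : forall t, (1 <= t)%N ->
       0 < alpha t <= 1 / (Num.sqrt 2 * L * N%:R))
    (alpha_sum : (\sum_(1 <= t <oo) (alpha t)%:E = +oo)%E)
    (alpha_cube_sum : (\sum_(1 <= t <oo) (alpha t ^+ 3)%:E < +oo)%E)
    (alpha_rho_sum :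
       (\sum_(1 <= t <oo | (cube_tail alpha t < eta)%E)
          (alpha t * (rho^`()%classic (fine (cube_tail alpha t)))^-1)%:E < +oo)%E) :
  [/\ (\sum_(1 <= t <oo)
         (alpha t * enorm (grad (average f) (x t.-1)))%:E < +oo)%E,
      (\sum_(1 <= t <oo) (enorm (x t - x t.-1))%:E < +oo)%E
    & exists2 xstar : 'rV[R]_n,
        x @ \oo --> xstar & grad (average f) xstar = 0].
Proof.
have f_diff i z : differentiable (f i) z by have [] := f_C1 i.
have F_diff z : differentiable (average f) z by exact: differentiable_average.
have F_lip : lipschitz_gradient L (average f).
  exact: lipschitz_gradient_average.
have F_lb : has_lbound (range (average f)).
  have /choice[lb lbP] : forall i, exists m, forall z, m <= f i z.
    by move=> i; have [m mP] := f_bounded_below i; exists m => z; apply: mP; exists z.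
  exists (N%:R^-1 * \sum_(i < N) lb i) => _ [z _ <-].
  by rewrite ler_wpM2l ?invr_ge0// ler_sum.
have [B xB] := enorm_bounded x_bounded.
have [G gradG] := lipschitz_gradient_bounded (ltW L_gt0) f_lipschitz xB.
have alpha_gt0 t : (1 <= t)%N -> 0 < alpha t by move=> /alpha_bounds/andP[].
have P_gt0 : 0 < (8 * N%:R)^-1 :> R by rewrite invr_gt0 mulr_gt0 ?ltr0n.
have step_sum := KL_finite_length (fun z => differentiable_continuous (F_diff z))
  F_lb x_bounded alpha_gt0 P_gt0
  (fun t t1 => random_reshuffling_descent N_gt0 L_gt0 f_diff f_lipschitz x_RR
     gradG t1 (alpha_bounds t t1))
  delta_gt0 eta_gt0 rhoQ f_uniform_KL alpha_cube_sum alpha_rho_sum.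
have slope_ge0 t : (1 <= t)%N ->
    0 <= alpha t * enorm (grad (average f) (x t.-1)).
  by move=> t1; rewrite mulr_ge0 ?enorm_ge0// ltW ?alpha_gt0.
have grad_sum : (\sum_(1 <= t <oo)
    (alpha t * enorm (grad (average f) (x t.-1)))%:E < +oo)%E.
  apply: (nneseries_lty_near (K := 1)) step_sum => [|t t1|t t1|] //.
  - exact: slope_ge0.
  - by rewrite addr_ge0 ?slope_ge0 ?enorm_ge0.
  - by apply: nearW => t; rewrite mul1r lerDl enorm_ge0.
have len_sum : (\sum_(1 <= t <oo) (enorm (x t - x t.-1))%:E < +oo)%E.
  apply: (nneseries_lty_near (K := 1)) step_sum => [|t t1|t t1|] //.
  - exact: enorm_ge0.
  - by rewrite addr_ge0 ?slope_ge0 ?enorm_ge0.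
  - by exists 1%N => // t /= t1; rewrite mul1r lerDr slope_ge0.
split => //.
have len_ge0 t : (1 <= t)%N -> 0 <= enorm (x t - x t.-1) by rewrite enorm_ge0.
have [c [_ _ _ len_le c0]] := nneseries_tail_fin len_ge0 len_sum.
have dist_le s t : (s <= t)%N -> enorm (x t - x s) <= c s.+1.
  move=> st; rewrite (le_trans _ (len_le s.+1 t.+1 isT))//.
  rewrite -(telescope_sumr x st) (le_trans (ler_enorm_sum _ _ _))//.
  by rewrite big_add1.
have [//|z Cz zclose] := @accumulation_point_along _ _ _ x_bounded setT.
  by move=> M; exists M.
(* Once a late iterate is within [e / 3] of [z] and the remaining length is below [e / 3], no later
   iterate can leave the [e]-ball. *)
have xz : x @ \oo --> z.
  apply/cvgrPdist_lt => e e_gt0.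
  have e3 : 0 < e / 3 by rewrite divr_gt0.
  have [T _ Tc] : \forall s \near \oo, c s.+1 < e / 3.
    have c1 : c s.+1 @[s --> \oo] --> 0 by rewrite cvg_shiftS.
    exact: cvgr_lt c1 _ e3.
  have [s [Ts _ xsz]] := zclose _ e3 T.
  exists s => // t /= st; rewrite distrC (le_lt_trans (ler_norm_enorm _))//.
  rewrite (le_lt_trans (ler_enorm_distD (x s) _ _))//.
  have := dist_le _ _ st; have := Tc _ Ts => /=; lra.
(* If the gradient at [z] had norm [kappa > 0], the gradients along the sequence would eventually
   exceed [kappa / 2], and summability of [alpha] times the gradient norm would contradict the
   divergence of the step sizes. *)
exists z => //; apply: contrapT => grad_neq0.
have gz : 0 < enorm (grad (average f) z).
  rewrite lt_neqAle enorm_ge0 andbT eq_sym; apply/eqP => /enorm_eq0.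
  exact: grad_neq0.
set kappa := enorm _ in gz.
suff : (\sum_(1 <= t <oo) (alpha t)%:E < +oo)%E by rewrite alpha_sum ltxx.
apply: (nneseries_lty_near (K := 2 / kappa)) grad_sum => //.
- by rewrite divr_ge0// ltW.
- by move=> t /alpha_gt0/ltW.
(* Within this radius of [z] the Lipschitz bound changes the gradient by less than [kappa / 2]. *)
have kL : 0 < kappa / (2 * L) by rewrite divr_gt0// mulr_gt0.
have [T _ xT] := cvgr_enorm_dist_lt xz kL.
exists T.+1 => // -[//|t] /= Tt; have /= := xT t Tt.
rewrite ltr_pdivlMr ?mulr_gt0// => xt.
rewrite mulrCA ler_peMr ?(ltW (alpha_gt0 t.+1 isT))//.
rewrite mulrAC ler_pdivlMr// mul1r.
have := ler_enormD (grad (average f) z - grad (average f) (x t))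
  (grad (average f) (x t)).
rewrite subrK -/kappa; have := F_lip z (x t); rewrite (enorm_distC z); lra.
Qed.
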